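(* Consider a deterministic positive semilinear problem with data $(X,U,U(\cdot),f,g,\alpha,\widehat{\mathcal M})$ satisfying Closure and Attainability, Stabilizability, State Space Structure, and Observability (all as defined in the context). Then there exists an optimal policy $\mu^*$ that belongs to $\widehat{\mathcal M}$ and is such that the matrix $\alpha A_{\mu^*}$ is stable.
   Context: Notation: $\mathbb R^n_+$ is the set of vectors in $\mathbb R^n$ with nonnegative components; a prime denotes transposition. Deterministic positive semilinear problem: the state space $X$ is a subset of $\mathbb R^n_+$, $U$ is a control space, and for each $x\in X$, $U(x)\subset U$ is a nonempty control constraint set. The functions $f:X\times U\to\mathbb R^n$ and $g:X\times U\to\mathbb R$ satisfy $f(x,u)\in X$ and $g(x,u)\ge 0$ for all $x\in X$, $u\in U(x)$; $\alpha\in(0,1]$ is a scalar. For $x_0\in X$, the problem is to minimize $\sum_{k=0}^\infty\alpha^k g(x_k,u_k)$ over control sequences $\{u_k\}$ subject to $x_{k+1}=f(x_k,u_k)$, $u_k\in U(x_k)$, $k=0,1,\dots$. $J^*(x_0)$ denotes the optimal cost (infimum) starting from $x_0$. A (stationary) policy is a function $\mu:X\to U$ with $\mu(x)\in U(x)$ for all $x\in X$; its cost function is $J_\mu(x_0)=\sum_{k=0}^\infty\alpha^k g(x_k,\mu(x_k))$ with $x_{k+1}=f(x_k,\mu(x_k))$; $\mu$ is optimal if $J_\mu(x)=J^*(x)$ for all $x\in X$. $\widehat{\mathcal M}$ is a given set of policies such that for every $\mu\in\widehat{\mathcal M}$ there exist an $n\times n$ nonnegative matrix $A_\mu$ and a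 vector $q_\mu\in\mathbb R^n$ with $f(x,\mu(x))=A_\mu x$ and $g(x,\mu(x))=q_\mu'x$ for all $x\in X$. $\widehat{\mathcal J}$ is the set of functions $J(x)=c'x$ on $X$ with $c\in\mathbb R^n_+$. A square matrix is stable if all its eigenvalues lie strictly within the unit circle. Assumptions: Closure and Attainability: for every $c\in\mathbb R^n_+$, the function $x\mapsto\min_{u\in U(x)}[g(x,u)+\alpha c'f(x,u)]$ belongs to $\widehat{\mathcal J}$, i.e., equals $\hat c'x$ for some unique $\hat c\in\mathbb R^n_+$; $\hat c$ depends continuously on $c$; and there is a policy $\mu\in\widehat{\mathcal M}$ with $\mu(x)\in\arg\min_{u\in U(x)}[g(x,u)+\alpha c'f(x,u)]$ for all $x\in X$. Stabilizability: there exists $\hat\mu\in\widehat{\mathcal M}$ such that $\alpha A_{\hat\mu}$ is stable. State Space Structure: for every $v\in\mathbb R^n_+$ there exist $x\in X$ and a scalar $s\ge0$ with $sx=v$. Observability: there exists an integer $N$ such that for every nonzero $x_0\in X$ the optimal cost of the $N$-stage problem of minimizing $\sum_{k=0}^{N-1}\alpha^k g(x_k,u_k)$ starting from $x_0$ is strictly positive. *)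

(* Defs.v *)
From HB Require Import structures.
From mathcomp Require Import all_boot all_order all_algebra.
From mathcomp Require Import all_classical all_reals all_analysis.
From mathcomp Require Import complex.

Set Implicit Arguments.
Unset Strict Implicit.
Unset Printing Implicit Defensive.

Import Order.TTheory GRing.Theory Num.Theory.
Import numFieldNormedType.Exports.

Local Open Scope classical_set_scope.
Local Open Scope ring_scope.

Definition nonneg_mx (R : realType) (m n : nat) (A : 'M[R]_(m, n)) : Prop :=
  forall i j, 0 <= A i j.

Definition dot (R : realType) (n : nat) (c x : 'cV[R]_n) : R :=
  (c^T *m x) 0 0.

(* Eigenvalues are taken in the complex numbers R[i]. *)
Definition stable_mx (R : realType) (n : nat) (A : 'M[R]_n) : Prop :=
  forall z : R[i], eigenvalue (map_mx (real_complex R) A) z -> `|z| < 1.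

(* dyn, stage_cost and policies are total functions; every
   condition below only involves their values at states x in X and controls
   u in U(x), so values elsewhere are irrelevant. *)
Definition policy_of (R : realType) (n : nat) (U : Type) (X : set 'cV[R]_n)
    (Ux : 'cV[R]_n -> set U) : set ('cV[R]_n -> U) :=
  [set mu | forall x, X x -> Ux x (mu x)].

Record semilinear_problem (R : realType) (n : nat) := SemilinearProblem {
  state : set 'cV[R]_n;
  control : Type;
  constr : 'cV[R]_n -> set control;
  dyn : 'cV[R]_n -> control -> 'cV[R]_n;
  stage_cost : 'cV[R]_n -> control -> R;
  discount : R;
  lin_policies : set ('cV[R]_n -> control);
  state_nonneg : forall x, state x -> nonneg_mx x;
  constr_nonempty : forall x, state x -> constr x !=set0;
  dyn_state : forall x u, state x -> constr x u -> state (dyn x u);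
  stage_cost_ge0 : forall x u, state x -> constr x u -> 0 <= stage_cost x u;
  discount_gt0 : 0 < discount;
  discount_le1 : discount <= 1;
  lin_policies_sub : lin_policies `<=` policy_of state constr;
  lin_policiesP : forall mu, lin_policies mu ->
    exists (A : 'M[R]_n) (q : 'cV[R]_n),
      [/\ nonneg_mx A,
          forall x, state x -> dyn x (mu x) = A *m x &
          forall x, state x -> stage_cost x (mu x) = dot q x]
}.

Arguments state {R n} s _.
Arguments constr {R n} s _ _.
Arguments dyn {R n} s _ _.
Arguments stage_cost {R n} s _ _.
Arguments lin_policies {R n} s _.

Section SemilinearProblem.
Variables (R : realType) (n : nat) (P : semilinear_problem R n).
Local Notation X := (state P).
Local Notation U := (control P).
Local Notation Ux := (constr P).
Local Notation f := (dyn P).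
Local Notation g := (stage_cost P).
Local Notation alpha := (discount P).
Local Notation Mhat := (lin_policies P).

Definition is_policy : set ('cV[R]_n -> U) := policy_of X Ux.

Fixpoint traj (u : nat -> U) (x0 : 'cV[R]_n) (k : nat) : 'cV[R]_n :=
  if k is k'.+1 then f (traj u x0 k') (u k') else x0.

Fixpoint policy_traj (mu : 'cV[R]_n -> U) (x0 : 'cV[R]_n) (k : nat) :
    'cV[R]_n :=
  if k is k'.+1 then f (policy_traj mu x0 k') (mu (policy_traj mu x0 k'))
  else x0.

Definition admissible (x0 : 'cV[R]_n) : set (nat -> U) :=
  [set u | forall k, Ux (traj u x0 k) (u k)].

Definition total_cost (x0 : 'cV[R]_n) (u : nat -> U) : \bar R :=
  (\sum_(0 <= k <oo) (alpha ^+ k * g (traj u x0 k) (u k))%:E)%E.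

Definition opt_cost (x0 : 'cV[R]_n) : \bar R :=
  ereal_inf [set total_cost x0 u | u in admissible x0].

Definition policy_cost (mu : 'cV[R]_n -> U) (x0 : 'cV[R]_n) : \bar R :=
  (\sum_(0 <= k <oo)
     (alpha ^+ k * g (policy_traj mu x0 k) (mu (policy_traj mu x0 k)))%:E)%E.

Definition optimal_policy (mu : 'cV[R]_n -> U) : Prop :=
  is_policy mu /\ forall x, X x -> policy_cost mu x = opt_cost x.

(* Only the controls u_0, ..., u_{N-1} matter here: they alone are
   constrained, and they alone enter the N-stage cost. *)
Definition admissible_upto (N : nat) (x0 : 'cV[R]_n) : set (nat -> U) :=
  [set u | forall k, (k < N)%N -> Ux (traj u x0 k) (u k)].

Definition stage_opt_cost (N : nat) (x0 : 'cV[R]_n) : \bar R :=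
  ereal_inf [set (\sum_(0 <= k < N) alpha ^+ k * g (traj u x0 k) (u k))%:E
            | u in admissible_upto N x0].

(* A is a matrix A_mu of the policy mu; under [state_space_structure] it is
   uniquely determined by mu. *)
Definition policy_matrix (mu : 'cV[R]_n -> U) (A : 'M[R]_n) : Prop :=
  nonneg_mx A /\ forall x, X x -> f x (mu x) = A *m x.

Definition stable_policy (mu : 'cV[R]_n -> U) : Prop :=
  exists A : 'M[R]_n, policy_matrix mu A /\ stable_mx (alpha *: A).

Definition bellman (c x : 'cV[R]_n) (u : U) : R :=
  g x u + alpha * dot c (f x u).

(* The minimum over U(x) is attained, with value v. *)
Definition bellman_min (c x : 'cV[R]_n) (v : R) : Prop :=
  [set bellman c x u | u in Ux x] v /\
  lbound [set bellman c x u | u in Ux x] v.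

Definition bellman_argmin (c x : 'cV[R]_n) : set U :=
  [set u | Ux x u /\ forall u', Ux x u' -> bellman c x u <= bellman c x u'].

Definition closure_attainability : Prop :=
  (exists chat : 'cV[R]_n -> 'cV[R]_n,
     (forall c, nonneg_mx c ->
        unique (fun d => nonneg_mx d /\
                         forall x, X x -> bellman_min c x (dot d x))
               (chat c)) /\
     {within [set c | nonneg_mx c], continuous chat}) /\
  (forall c, nonneg_mx c ->
     exists mu, Mhat mu /\ forall x, X x -> bellman_argmin c x (mu x)).

Definition stabilizability : Prop :=
  exists mu, Mhat mu /\ stable_policy mu.

Definition state_space_structure : Prop :=
  forall v : 'cV[R]_n, nonneg_mx v ->
    exists x (s : R), [/\ X x, 0 <= s & s *: x = v].

Definition observability : Prop :=
  exists N : nat, forall x0, X x0 -> x0 != 0 -> (0 < stage_opt_cost N x0)%E.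

End SemilinearProblem.

(* Main.v *)
(* Value iteration c_0 = 0, c_(k+1) = T c_k (T c is the vector c-hat of the
   Closure assumption) increases, and the stabilizing policy, with matrix
   B = alpha A and stage cost q'x, gives c_k'x <= sum_(j < k) q' B^j x. These
   sums are bounded: by Cayley-Hamilton a product of factors B - z with |z| < 1
   annihilates B^k x, and peeling off one factor at a time bounds the sum of
   |B^k x|. Hence c_k converges, by continuity to a fixed point c of T. Since
   c_k'x is a lower bound for the cost of the first k stages, c'x <= J*(x);
   and a policy mu of M-hat attaining the minimum for c costs at most c'x by
   telescoping, so it is optimal. The same telescoping over N stages and
   Observability give c'B^N v < c'v for nonzero v >= 0, with B now the matrix of
   mu, which forces every eigenvalue of B into the open unit disk. *)
Require Import Defs.
From mathcomp Require Import all_boot all_order all_algebra.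
From mathcomp Require Import all_classical all_reals all_analysis.
From mathcomp Require Import complex.

Set Implicit Arguments.
Unset Strict Implicit.
Unset Printing Implicit Defensive.

Import Order.TTheory GRing.Theory Num.Theory.
Import numFieldNormedType.Exports.

Local Open Scope classical_set_scope.
Local Open Scope ring_scope.

(** * Orbit sums of a matrix with spectrum in the open unit disk *)

Local Notation powv B k v := (iter k (mulmx B) v).

Lemma powv0 (F : pzRingType) n (B : 'M[F]_n) k : powv B k (0 : 'cV_n) = 0.
Proof. by elim: k => //= k ->; rewrite mulmx0. Qed.

Lemma powvD (F : pzRingType) n (B : 'M[F]_n) k (v w : 'cV[F]_n) :
  powv B k (v + w) = powv B k v + powv B k w.
Proof. by elim: k => //= k ->; rewrite mulmxDr. Qed.

Lemma powvZ (F : comPzRingType) n (B : 'M[F]_n) k a (v : 'cV[F]_n) :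
  powv B k (a *: v) = a *: powv B k v.
Proof. by elim: k => //= k ->; rewrite scalemxAr. Qed.

(** Let S_K(v) be the sum at a fixed coordinate and w = (B - z) v. From B^(k+1) v = z B^k v + B^k w
    follows S_K(v) <= S_(K+1)(v) <= |v_i| + |z| S_K(v) + M, where M bounds the sums for w; since |z|
    < 1 this can be solved for S_K(v). *)
Lemma powv_annihilated_sum_bounded (C : numFieldType) n (B : 'M[C]_n.+1)
    (s : seq C) (v : 'cV[C]_n.+1) :
  all (fun z => `|z| < 1) s ->
  horner_mx B (\prod_(z <- s) ('X - z%:P)) *m v = 0 ->
  exists M, forall K i, \sum_(k < K) `|powv B k v i 0| <= M.
Proof.
elim: s v => [v _|z s IHs v /andP[z_lt1 s_lt1]].
  rewrite big_nil rmorph1 mul1mx => ->; exists 0 => K i.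
  by rewrite big1 // => k _; rewrite powv0 mxE normr0.
rewrite big_cons mulrC rmorphM rmorphB /= horner_mx_X horner_mx_C.
rewrite -mulmxE -mulmxA => /IHs-/(_ s_lt1)[M sumM].
have stepE k : powv B k.+1 v = z *: powv B k v + powv B k ((B - z%:M) *m v).
  by rewrite iterSr mulmxBl mul_scalar_mx -powvZ -powvD addrC subrK.
(* Summing all [|v i 0|] instead of taking one entry makes the constant independent of [i]. *)
exists ((\sum_i `|v i 0| + M) / (1 - `|z|)) => K i.
rewrite ler_pdivlMr ?subr_gt0 // mulrBr mulr1 lerBlDr.
have le_step : \sum_(k < K) `|powv B k v i 0| <=
    \sum_(k < K.+1) `|powv B k v i 0|.
  by rewrite big_ord_recr /= lerDl.
apply: le_trans le_step _; rewrite big_ord_recl.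
have vi_le : `|v i 0| <= \sum_i `|v i 0|.
  by rewrite (bigD1 i) //= lerDl sumr_ge0.
rewrite -addrA lerD // [leRHS]addrC mulr_suml.
apply: le_trans (_ : \sum_(k < K) (`|powv B k v i 0| * `|z| +
    `|powv B k ((B - z%:M) *m v) i 0|) <= _).
  apply: ler_sum => k _.
  rewrite lift0 stepE mxE [X in `|X + _|]mxE.
  by rewrite (le_trans (ler_normD _ _)) // normrM mulrC.
by rewrite big_split lerD2l; apply: sumM.
Qed.

Lemma powv_sum_bounded (C : numClosedFieldType) n (B : 'M[C]_n) :
  (forall z, eigenvalue B z -> `|z| < 1) ->
  forall v : 'cV[C]_n,
  exists M, forall K i, \sum_(k < K) `|powv B k v i 0| <= M.
Proof.
case: n B => [|n] B eigen_lt1 v; first by exists 0 => K [].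
have [s] := closed_field_poly_normal (char_poly B).
rewrite (monicP (char_poly_monic B)) scale1r => char_polyE.
apply: (@powv_annihilated_sum_bounded _ _ _ s).
  apply/allP => z s_z; apply: eigen_lt1.
  by rewrite eigenvalue_root_char char_polyE root_prod_XsubC.
by rewrite -char_polyE Cayley_Hamilton mul0mx.
Qed.

(** * Nonnegative real vectors and a stability criterion *)

Section RealVectors.
Variables (R : realType) (n : nat).
Implicit Types (B : 'M[R]_n) (c d v w : 'cV[R]_n).

Lemma dotE c v : dot c v = \sum_i c i 0 * v i 0.
Proof. by rewrite /dot mxE; apply: eq_bigr => i _; rewrite mxE. Qed.

Lemma dotDl c d v : dot (c + d) v = dot c v + dot d v.
Proof. by rewrite /dot linearD mulmxDl mxE. Qed.

Lemma dotZr c a v : dot c (a *: v) = a * dot c v.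
Proof. by rewrite /dot -scalemxAr mxE. Qed.

Lemma dot0l v : dot 0 v = 0.
Proof. by rewrite /dot linear0 mul0mx mxE. Qed.

Lemma dot_trmx B c v : dot (B^T *m c) v = dot c (B *m v).
Proof. by rewrite /dot trmx_mul trmxK mulmxA. Qed.

Lemma dot_delta c i : dot c (delta_mx i 0) = c i 0.
Proof.
rewrite dotE (bigD1 i) //= mxE !eqxx mulr1 big1 ?addr0 // => j ji.
by rewrite mxE (negPf ji) mulr0.
Qed.

Lemma delta_nonneg i : nonneg_mx (delta_mx i 0 : 'cV[R]_n).
Proof. by move=> j k; rewrite mxE ler0n. Qed.

Lemma dot_ge0 c v : nonneg_mx c -> nonneg_mx v -> 0 <= dot c v.
Proof. by move=> c0 v0; rewrite dotE sumr_ge0 // => i _; rewrite mulr_ge0. Qed.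

Lemma ler_dotl c d v :
  (forall i, c i 0 <= d i 0) -> nonneg_mx v -> dot c v <= dot d v.
Proof. by move=> cd v0; rewrite !dotE ler_sum // => i _; rewrite ler_wpM2r. Qed.

Lemma ler_dotr c v w :
  nonneg_mx c -> (forall i, v i 0 <= w i 0) -> dot c v <= dot c w.
Proof. by move=> c0 vw; rewrite !dotE ler_sum // => i _; rewrite ler_wpM2l. Qed.

Lemma mulmx_nonneg B v : nonneg_mx B -> nonneg_mx v -> nonneg_mx (B *m v).
Proof.
by move=> B0 v0 i j; rewrite mxE sumr_ge0 // => k _; rewrite mulr_ge0.
Qed.

Lemma powv_nonneg B k v :
  nonneg_mx B -> nonneg_mx v -> nonneg_mx (powv B k v).
Proof. by move=> B0 v0; elim: k => //= k; apply: mulmx_nonneg. Qed.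

Lemma stable_powv_sum_bounded B v : stable_mx B ->
  exists M, forall K i, \sum_(k < K) `|powv B k v i 0| <= M.
Proof.
move=> stB.
have [M sumM] := powv_sum_bounded stB (map_mx (real_complex R) v).
(* An inequality between a real number and [M] in [R[i]] compares their real parts. *)
exists (complex.Re M) => K i; have := sumM K i.
have powvE k : powv (map_mx (real_complex R) B) k (map_mx (real_complex R) v) =
    map_mx (real_complex R) (powv B k v).
  by elim: k => //= k ->; rewrite map_mxM.
have normE (x : R) : `|(real_complex R x)| = real_complex R `|x|.
  by rewrite normc_def /= expr0n addr0 sqrtr_sqr.
under eq_bigr do rewrite powvE mxE normE.
by rewrite -rmorph_sum lecE => /andP[].
Qed.

(** [eigenvalue] refers to row vectors; a matrix and its transpose share their characteristic
    polynomial, which yields a column eigenvector. *)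
Lemma eigenvalue_colP (F : fieldType) m (A : 'M[F]_m) z :
  eigenvalue A z -> exists2 w : 'cV[F]_m, A *m w = z *: w & w != 0.
Proof.
have -> : eigenvalue A z = eigenvalue A^T z.
  rewrite !eigenvalue_root_char /char_poly -det_tr; congr (root (\det _) z).
  by apply/matrixP => i j; rewrite !mxE eq_sym.
move=> /eigenvalueP[v vA v0]; exists v^T; last first.
  by apply: contra v0 => /eqP/(congr1 trmx); rewrite trmxK trmx0 => ->.
by rewrite -[LHS]trmxK trmx_mul trmxK vA linearZ.
Qed.

(* For a right eigenvector w of eigenvalue z, |z|^N |w| <= B^N |w| entrywise;
   pairing with c gives |z|^N < 1. *)
Lemma stable_mx_of_decrease B c N :
  nonneg_mx B -> nonneg_mx c ->
  (forall v, nonneg_mx v -> v != 0 -> dot c (powv B N v) < dot c v) ->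
  stable_mx B.
Proof.
move=> B0 c0 decr z /eigenvalue_colP[w Bw w0].
have normE (x : R[i]) : `|x| = real_complex R (complex.Re `|x|).
  by rewrite normc_def.
pose r : R := complex.Re `|z|.
have r0 : 0 <= r by have := normr_ge0 z; rewrite normE lecE => /andP[].
pose u : 'cV[R]_n := \col_i complex.Re `|w i 0|.
have u0 : nonneg_mx u.
  move=> i j; rewrite mxE.
  by have := normr_ge0 (w i 0); rewrite normE lecE => /andP[].
have un0 : u != 0.
  apply: contra w0 => /eqP/matrixP uE; apply/eqP/matrixP => i j.
  rewrite (ord1 j) [RHS]mxE; apply/eqP; rewrite -normr_eq0 normE.
  by have := uE i 0; rewrite !mxE => ->.
have ru i : r * u i 0 <= (B *m u) i 0.
  have : real_complex R (r * u i 0) <= real_complex R ((B *m u) i 0).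
    rewrite rmorphM /= /r -normE mxE -normE -normrM.
    have -> : z * w i 0 = (z *: w) i 0 by rewrite mxE.
    rewrite -Bw mxE (le_trans (ler_norm_sum _ _ _)) // mxE rmorph_sum.
    apply: ler_sum => j _.
    rewrite normrM rmorphM /= !mxE -normE ler_wpM2r //.
    by rewrite normc_def /= expr0n addr0 sqrtr_sqr ger0_norm.
  by rewrite lecE => /andP[].
have rku k i : r ^+ k * u i 0 <= powv B k u i 0.
  elim: k i => [|k IHk] i; first by rewrite mul1r.
  rewrite exprSr -mulrA (le_trans (ler_wpM2l (exprn_ge0 k r0) (ru i))) //.
  rewrite /= !mxE mulr_sumr ler_sum // => j _.
  by rewrite mulrCA ler_wpM2l.
have : r ^+ N * dot c u < dot c u.
  apply: le_lt_trans (decr u u0 un0); rewrite -dotZr.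
  by apply: ler_dotr => // i; rewrite mxE.
(* The strict inequality itself rules out [dot c u = 0], so dividing by it is legitimate. *)
have [->|cu0] := eqVneq (dot c u) 0; first by rewrite mulr0 ltxx.
have cu_gt0 : 0 < dot c u by rewrite lt_def cu0 dot_ge0.
rewrite -ltr_pdivlMr // divff // => rN_lt1.
rewrite normE -/r -(rmorph1 (real_complex R)) ltcR.
by rewrite ltNge; apply: contraTN rN_lt1 => r1; rewrite -leNgt exprn_ege1.
Qed.

End RealVectors.

(** There are finitely many entries, so one threshold serves them all. *)
Lemma cvg_mx_coord (R : realType) m n (u : nat -> 'M[R]_(m, n))
    (l : 'M[R]_(m, n)) :
  (forall i j, u k i j @[k --> \oo] --> l i j) -> u k @[k --> \oo] --> l.
Proof.
move=> ul; apply/cvg_mx_entourageP => A entA.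
have nearA : \forall k \near \oo, forall ij : 'I_m * 'I_n,
    A (l ij.1 ij.2, u k ij.1 ij.2).
  apply: filter_forall => -[i j] /=.
  by have /cvg_entourageP/(_ A entA) := ul i j.
by apply: filterS nearA => k Ak i j; rewrite inE; apply: (Ak (i, j)).
Qed.

(** * Trajectories and costs of policies *)

Section ValueIteration.
Variables (R : realType) (n : nat) (P : semilinear_problem R n).
Local Notation X := (state P).
Local Notation f := (dyn P).
Local Notation g := (stage_cost P).
Local Notation alpha := (discount P).
Implicit Types (mu : 'cV[R]_n -> control P) (x : 'cV[R]_n).
Hypothesis state_space : state_space_structure P.

(** Every nonnegative vector is a nonnegative multiple of a state, so a linear inequality checked on
    states extends to the orthant, in particular to the basis vectors that read off coordinates. *)
Lemma state_ler_dot (c d : 'cV[R]_n) :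
  (forall x, X x -> dot c x <= dot d x) ->
  forall v, nonneg_mx v -> dot c v <= dot d v.
Proof.
move=> cd v /state_space[x [s [Xx s0 <-]]].
by rewrite !dotZr ler_wpM2l // cd.
Qed.

Lemma traj_state N x (u : nat -> control P) :
  X x -> admissible_upto N x u -> forall k, (k <= N)%N -> X (traj u x k).
Proof.
move=> Xx adm; elim=> //= k IHk kN; apply: dyn_state; first exact/IHk/ltnW.
exact: adm.
Qed.

Lemma policy_traj_state mu x k :
  is_policy mu -> X x -> X (policy_traj mu x k).
Proof. by move=> muP Xx; elim: k => //= k IHk; apply/dyn_state/muP. Qed.

Lemma policy_traj_traj mu x k :
  traj (fun j => mu (policy_traj mu x j)) x k = policy_traj mu x k.
Proof. by elim: k => //= k ->. Qed.

(** Absorbing the discount into the matrix turns the tail of the telescoped cost into a power of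
    [alpha *: A]. *)
Lemma policy_traj_powv mu A x k :
  is_policy mu -> policy_matrix mu A -> X x ->
  alpha ^+ k *: policy_traj mu x k = powv (alpha *: A) k x.
Proof.
move=> muP [_ fA] Xx; elim: k => [|k IHk] /=; first by rewrite scale1r.
rewrite fA; last exact: policy_traj_state.
by rewrite -IHk -scalemxAl -scalemxAr scalerA exprS.
Qed.

Lemma opt_cost_le_policy_cost mu x :
  is_policy mu -> X x -> (opt_cost P x <= policy_cost mu x)%E.
Proof.
move=> muP Xx; apply: ereal_inf_lbound.
exists (fun k => mu (policy_traj mu x k)).
  by move=> k; rewrite policy_traj_traj; apply/muP/policy_traj_state.
by congr (limn _); apply/funext => k; apply: eq_bigr => j _;
   rewrite policy_traj_traj.
Qed.

Lemma stage_opt_cost_le_policy mu x N :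
  is_policy mu -> X x ->
  (stage_opt_cost P N x <=
   (\sum_(k < N) alpha ^+ k *
      g (policy_traj mu x k) (mu (policy_traj mu x k)))%:E)%E.
Proof.
move=> muP Xx; apply: ereal_inf_lbound.
exists (fun k => mu (policy_traj mu x k)).
  by move=> k _; rewrite policy_traj_traj; apply/muP/policy_traj_state.
by rewrite big_mkord; congr (_%:E); apply: eq_bigr => k _;
   rewrite policy_traj_traj.
Qed.

(** Bellman's equation at the current state trades c'x_k for the stage cost plus alpha c'x_(k+1).
    Dropping the nonnegative tail bounds the policy cost; keeping it measures the decrease of c
    along the orbit. *)
Lemma policy_cost_telescope c mu x K :
  is_policy mu -> X x ->
  (forall y, X y -> bellman c y (mu y) = dot c y) ->
  dot c x =
    \sum_(k < K) alpha ^+ k * g (policy_traj mu x k) (mu (policy_traj mu x k))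
    + dot c (alpha ^+ K *: policy_traj mu x K).
Proof.
move=> muP Xx fixc; elim: K => [|K IHK].
  by rewrite big_ord0 add0r scale1r.
rewrite big_ord_recr /= IHK -addrA; congr (_ + _).
rewrite !dotZr -{1}fixc; last exact: policy_traj_state.
by rewrite /bellman exprSr mulrDr mulrA.
Qed.

Lemma policy_cost_le c mu x :
  is_policy mu -> X x -> nonneg_mx c ->
  (forall y, X y -> bellman c y (mu y) = dot c y) ->
  (policy_cost mu x <= (dot c x)%:E)%E.
Proof.
move=> muP Xx c0 fixc; have trajX k := policy_traj_state k muP Xx.
apply: lime_le.
  apply: is_cvg_nneseries => k _ _; rewrite lee_fin mulr_ge0 ?exprn_ge0 //.
    exact/ltW/discount_gt0.
  by apply: stage_cost_ge0 => //; apply: muP.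
near=> K; rewrite sumEFin lee_fin big_mkord.
rewrite (policy_cost_telescope K muP Xx fixc) lerDl dotZr mulr_ge0 //.
  exact/exprn_ge0/ltW/discount_gt0.
by apply: dot_ge0 => //; apply/state_nonneg/trajX.
Unshelve. all: by end_near. Qed.

(** * Value iteration and its limit *)

Variable T : 'cV[R]_n -> 'cV[R]_n.
Hypothesis T_nonneg : forall c, nonneg_mx c -> nonneg_mx (T c).
Hypothesis T_le : forall c, nonneg_mx c ->
  forall x u, X x -> constr P x u -> dot (T c) x <= bellman c x u.
Hypothesis T_attained : forall c, nonneg_mx c ->
  exists mu, lin_policies P mu /\
    forall x, X x -> bellman c x (mu x) = dot (T c) x.

Local Notation value k := (iter k T 0).

Lemma value_nonneg k : nonneg_mx (value k).
Proof. by elim: k => [i j|k]; [rewrite mxE | exact: T_nonneg]. Qed.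

(** The minimizing policy for [d] is a candidate in the minimization for [c], where its cost is no
    larger. *)
Lemma T_monotone c d : nonneg_mx c -> nonneg_mx d ->
  (forall i, c i 0 <= d i 0) -> forall i, T c i 0 <= T d i 0.
Proof.
move=> c0 d0 cd i; rewrite -!dot_delta.
apply: state_ler_dot; last exact: delta_nonneg.
move=> x Xx; have [mu [/lin_policies_sub muP muE]] := T_attained d0.
rewrite -muE // (le_trans (T_le c0 Xx (muP _ Xx))) // /bellman lerD2l.
rewrite ler_wpM2l ?(ltW (discount_gt0 P)) // ler_dotl //.
exact/state_nonneg/dyn_state/muP.
Qed.

Lemma value_leS k i : value k i 0 <= value k.+1 i 0.
Proof.
elim: k i => [|k IHk] i; first by rewrite mxE (value_nonneg 1).
exact: T_monotone (value_nonneg k) (value_nonneg k.+1) IHk i.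
Qed.

(** The free [j] carries the induction: the last stage is split off by using the hypothesis at
    [j.+1], then bounding [T (value j)] by the control actually applied. *)
Lemma value_le_cost N j x u :
  X x -> admissible_upto N x u ->
  dot (value (N + j)) x <=
    \sum_(k < N) alpha ^+ k * g (traj u x k) (u k)
    + alpha ^+ N * dot (value j) (traj u x N).
Proof.
move=> Xx; elim: N j => [|N IHN] j adm; first by rewrite big_ord0 add0r mul1r.
have trajX := traj_state Xx adm.
rewrite addSnnS big_ord_recr /= (le_trans (IHN _ _)) //.
  by move=> k /ltnW; apply: adm.
rewrite -addrA lerD2l exprSr -mulrA -mulrDr ler_wpM2l //.
  exact/exprn_ge0/ltW/discount_gt0.
by apply: T_le; [exact: value_nonneg | exact/trajX/leqnSn | exact: adm].
Qed.

Lemma value_le_opt_cost k x : X x -> ((dot (value k) x)%:E <= opt_cost P x)%E.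
Proof.
move=> Xx; apply: le_ereal_inf_tmp => _ [u adm <-].
have adm_upto N : admissible_upto N x u by move=> j _; apply: adm.
apply: le_trans (nneseries_lim_ge k _).
  rewrite sumEFin lee_fin big_mkord; have := value_le_cost 0 Xx (adm_upto k).
  by rewrite addn0 dot0l mulr0 addr0.
move=> j _ _; rewrite lee_fin mulr_ge0 ?exprn_ge0 ?(ltW (discount_gt0 P)) //.
apply: stage_cost_ge0; last exact: adm.
exact: (traj_state Xx (adm_upto j)).
Qed.

(** The induction passes from [v] to [B *m v], which need not be a state even if [v] is one; hence
    the quantification over the orthant. *)
Lemma value_le_powv mu A q :
  lin_policies P mu -> policy_matrix mu A ->
  (forall x, X x -> g x (mu x) = dot q x) ->
  forall k v, nonneg_mx v ->
  dot (value k) v <= \sum_(j < k) dot q (powv (alpha *: A) j v).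
Proof.
move=> /lin_policies_sub muP [A0 fA] gq; pose B := alpha *: A.
have B0 : nonneg_mx B.
  by move=> i j; rewrite mxE mulr_ge0 // ltW // discount_gt0.
elim=> [|k IHk] v v0; first by rewrite big_ord0 dot0l.
(* [q + B^T *m value k] represents one stage of [mu] followed by the terminal cost [value k]. *)
apply: le_trans (_ : dot (q + B^T *m value k) v <= _).
  apply: state_ler_dot v0 => x Xx.
  rewrite (le_trans (T_le (value_nonneg k) Xx (muP _ Xx))) // /bellman.
  by rewrite gq // fA // dotDl dot_trmx /B -scalemxAl dotZr.
rewrite dotDl dot_trmx big_ord_recl lerD2l.
rewrite (le_trans (IHk _ (mulmx_nonneg B0 v0))) //.
by apply: ler_sum => j _; rewrite lift0 iterSr.
Qed.

Lemma value_bounded : stabilizability P ->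
  forall i, exists M, forall k, value k i 0 <= M.
Proof.
move=> [mu [mu_lin [A [muA stA]]]] i.
have [_ [q [_ _ gq]]] := lin_policiesP mu_lin.
have [M sumM] := stable_powv_sum_bounded (delta_mx i 0) stA.
exists (\sum_l `|q l 0| * M) => k; rewrite -dot_delta.
apply: le_trans (value_le_powv mu_lin muA gq k (@delta_nonneg _ _ i)) _.
under eq_bigr do rewrite dotE.
rewrite exchange_big /= ler_sum // => l _; rewrite -mulr_sumr.
rewrite (le_trans (ler_norm _)) // normrM ler_wpM2l //.
exact: le_trans (ler_norm_sum _ _ _) (sumM k l).
Qed.

Lemma value_cvg : stabilizability P ->
  exists2 c, nonneg_mx c & value k @[k --> \oo] --> c.
Proof.
move=> stab; pose c : 'cV[R]_n := \col_i limn (fun k => value k i 0).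
have homo i : {homo (fun k => value k i 0) : k l / (k <= l)%N >-> k <= l}.
  by apply: homo_leq => [//|?|k]; [exact: le_trans | exact: value_leS].
have cvg_value i : cvgn (fun k => value k i 0).
  have [M valM] := value_bounded stab i.
  by apply: nondecreasing_is_cvgn => //; exists M => _ [k _ <-].
exists c.
  move=> i j; rewrite mxE; apply: limr_ge; first exact: cvg_value.
  by near=> k; apply: value_nonneg.
by apply: cvg_mx_coord => i j; rewrite mxE (ord1 j); exact: cvg_value.
Unshelve. all: by end_near. Qed.

Lemma value_limit_fixed c :
  {within [set c | nonneg_mx c], continuous T} ->
  nonneg_mx c -> value k @[k --> \oo] --> c -> T c = c.
Proof.
move=> /subspace_continuousP T_cont c0 value_c.
have : T (value k) @[k --> \oo] --> T c.
  (* [T] is continuous only relative to the orthant, so the iterates must be known to lie in it. *)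
  apply: (cvg_comp (fun k => value k) T _ (T_cont c c0)) => A nearA.
  have near_value : \forall k \near \oo, nonneg_mx (value k) -> A (value k) :=
    value_c _ nearA.
  by apply: filterS near_value => k; apply; apply: value_nonneg.
(* [value k.+1] is [T (value k)], so this sequence tends both to [c] and to [T c]. *)
have shift_c : value k.+1 @[k --> \oo] --> c.
  by move: value_c; rewrite -(cvg_shiftS (fun k => value k)).
move=> Tvalue; apply/matrixP => i j.
have coord (u : nat -> 'cV[R]_n) (l : 'cV[R]_n) : u k @[k --> \oo] --> l ->
    u k i j @[k --> \oo] --> l i j.
  move=> ul; apply: (cvg_comp u (fun M => M i j) ul).
  exact: coord_continuous.
exact: cvg_unique (coord _ _ Tvalue) (coord _ _ shift_c).
Qed.

Lemma value_limit_le_opt_cost c x :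
  value k @[k --> \oo] --> c -> X x -> ((dot c x)%:E <= opt_cost P x)%E.
Proof.
move=> value_c Xx.
have cvg_dot : dot (value k) x @[k --> \oo] --> dot c x.
  have -> : (fun k => dot (value k) x) =
      (fun k => \sum_i value k i 0 * x i 0) by apply/funext => k; rewrite dotE.
  rewrite dotE; apply: cvg_big => [|i _]; first exact: add_continuous.
  apply: cvgMr_tmp.
  apply: (cvg_comp (fun k => value k) (fun M => M i 0) value_c).
  exact: coord_continuous.
apply: (@cvge_le _ \oo _ _ (fun k => (dot (value k) x)%:E)).
  by apply: nearW => k; apply: value_le_opt_cost.
by apply: cvg_EFin => //; apply: nearW.
Qed.

End ValueIteration.

(** * Optimality and stability of the policy attaining the minimum at the fixed point *)

Theorem proposition2 (R : realType) (n : nat) (P : semilinear_problem R n)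
  (closure_attain : closure_attainability P)
  (stabilizable : stabilizability P)
  (state_space : state_space_structure P)
  (observable : observability P) :
  exists mu : 'cV[R]_n -> control P,
    [/\ lin_policies P mu, optimal_policy mu & stable_policy mu].
Proof.
have [[T [T_unique T_cont]] attain] := closure_attain.
have T_nonneg c : nonneg_mx c -> nonneg_mx (T c) by case/T_unique => -[].
have T_le c : nonneg_mx c -> forall x u, state P x -> constr P x u ->
    dot (T c) x <= bellman c x u.
  move=> /T_unique[[_ Tmin] _] x u Xx ux.
  by have [_] := Tmin x Xx; apply; exists u.
have T_attained c : nonneg_mx c -> exists mu, lin_policies P mu /\
    forall x, state P x -> bellman c x (mu x) = dot (T c) x.
  move=> c0; have [mu [mu_lin argmin]] := attain c c0.
  exists mu; split=> // x Xx; have [mux mu_min] := argmin x Xx.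
  have [[_ Tmin] _] := T_unique c c0.
  have [[u ux uE] _] := Tmin x Xx.
  by apply/eqP; rewrite eq_le -{1}uE mu_min //= T_le.
have [c c0 value_c] :=
  value_cvg state_space T_nonneg T_le T_attained stabilizable.
have Tc : T c = c := value_limit_fixed T_nonneg T_cont c0 value_c.
have [mu [mu_lin]] := T_attained c c0; rewrite Tc => fixc.
have muP := lin_policies_sub mu_lin.
exists mu; split=> //.
  split=> // x Xx; apply/eqP; rewrite eq_le opt_cost_le_policy_cost // andbT.
  apply: le_trans (policy_cost_le muP Xx c0 fixc) _.
  exact: (value_limit_le_opt_cost T_nonneg T_le).
have [A [_ [A0 fA _]]] := lin_policiesP mu_lin.
have muA : policy_matrix mu A by [].
exists A; split=> //.
have [N obsN] := observable.
apply: (stable_mx_of_decrease (c := c) (N := N)) => //.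
  by move=> i j; rewrite mxE mulr_ge0 // ltW // discount_gt0.
(* By homogeneity the decrease need only be shown at a nonzero state, where Observability
   applies. *)
move=> _ /state_space[x [s [Xx s0 <-]]].
rewrite scaler_eq0 negb_or => /andP[sn0 xn0].
rewrite powvZ !dotZr ltr_pM2l; last by rewrite lt_def sn0.
rewrite (policy_cost_telescope N muP Xx fixc) (policy_traj_powv _ muP muA Xx).
(* The drop of c over [N] stages is exactly the [N]-stage cost of [mu]. *)
rewrite ltrDr -lte_fin; apply: lt_le_trans (obsN x Xx xn0) _.
exact: stage_opt_cost_le_policy.
Qed.
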